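(* (i) If $\Gamma$ is an $\mathcal F\cap\mathcal P$-grammar transform, then for all $w\in\mathbb X^+$ $$\mathbf V[\Gamma(w)]\,\mathbf L(w)>\sqrt{|\Gamma(w)|/2}-D-1 .$$ (ii) If $\Gamma$ is an $\mathcal I$-grammar transform, then for all $w\in\mathbb X^+$ $$\mathbf V[\Gamma(w)]>\sqrt{|\Gamma(w)|/2}-D-1 .$$
   Context: Let $D$ be a positive integer and $\mathbb X=\{0,1,\dots,D-1\}$ the terminal alphabet; $\mathbb X^+$ is the set of nonempty finite strings over $\mathbb X$ and $\mathbb X^*$ the set of all finite strings. Grammars. An admissible grammar is a finite sequence $G=(\alpha_1,\dots,\alpha_n)$, $n\ge1$, with $\alpha_i\in(\{A_{i+1},\dots,A_n\}\cup\mathbb X)^+$, where $A_1,A_2,\dots$ are nonterminal symbols; it stands for the context-free grammar with rules $A_i\to\alpha_i$ and start symbol $A_1$, which generates exactly one string $w\in\mathbb X^+$. Nonterminals $A_i$ with $i>1$ are called secondary. The vocabulary size is $\mathbf V[G]=n$ and the Yang-Kieffer length is $|G|=\sum_i|\alpha_i|$, where $|\alpha_i|$ is the number of symbols in $\alpha_i$. $\mathcal G$ is the set of admissible grammars, $\mathcal G(w)$ the set of those generating $w$. $\langle\alpha\rangle_G$ is the expansion of $\alpha$, i.e. the terminal string obtained by fully rewriting $\alpha$ with the rules of $G$. For $\mathcal J\subset\mathcal G$, a $\mathcal J$-grammar transform is a function $\Gamma:\mathbb X^+\to\mathcal J$ with $\Gamma(w)\in\mathcal G(w)$ for all $w$.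 Classes. $\mathcal F$ is the set of flat grammars: those with $\alpha_i\in\mathbb X^+$ for all $i>1$. $\mathcal I$ is the set of irreducible grammars $G=(\alpha_1,\dots,\alpha_n)$, i.e. those such that: (a) the expansions $\langle\alpha_i\rangle_G$ are pairwise distinct and $|\alpha_i|>1$ for all $i$ (except that $|\alpha_1|=1$ is allowed when $G$ generates a string of length one); (b) each secondary nonterminal appears in the string $\alpha_1\alpha_2\cdots\alpha_n$ at least twice; (c) each pair of consecutive symbols in the strings $\alpha_1,\dots,\alpha_n$ appears at most once at nonoverlapping positions (i.e. no two-symbol string has two nonoverlapping occurrences within the collection $\alpha_1,\dots,\alpha_n$, occurrences in different $\alpha_i$ counting as nonoverlapping). $\mathcal P$ is the set of partially irreducible grammars: those satisfying (a), (b), and the condition that each pair of consecutive symbols in the string $\alpha_1$ appears at most once in $\alpha_1$ at nonoverlapping positions. Longest nonoverlapping repeat: $\mathbf L(w)=\max\{|s|: w=xsysz,\ s,x,y,z\in\mathbb X^*\}$. *)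

(* Defs.v *)
From mathcomp Require Import all_boot all_order all_algebra.
Set Implicit Arguments.
Unset Strict Implicit.
Unset Printing Implicit Defensive.

(* Indices start at 0: the terminal alphabet is 'I_D, [nonterm D i] is the
   nonterminal A_(i+1), and [rhs G i] is the right-hand side alpha_(i+1), so
   that the start symbol is [nonterm D 0]. *)
Definition symbol (D : nat) : eqType := (nat + 'I_D)%type.
Definition nonterm (D i : nat) : symbol D := inl i.
Definition term (D : nat) (a : 'I_D) : symbol D := inr a.

Definition nonempty_string (D : nat) : Type := {w : seq 'I_D | w != [::]}.

Definition rhs (D : nat) (G : seq (seq (symbol D))) (i : nat) :
  seq (symbol D) := nth [::] G i.

Definition admissible (D : nat) (G : seq (seq (symbol D))) : Prop :=
  0 < size G /\
  forall i, i < size G ->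
    rhs G i != [::] /\
    forall j, nonterm D j \in rhs G i -> i < j < size G.

Record grammar (D : nat) : Type := Grammar {
  rules :> seq (seq (symbol D));
  rulesP : admissible rules
}.

Definition vocabulary_size (D : nat) (G : grammar D) : nat := size G.

Definition yk_length (D : nat) (G : grammar D) : nat :=
  \sum_(alpha <- G) size alpha.

Definition rewrite_symbol (D : nat) (G : seq (seq (symbol D)))
    (a : symbol D) : seq (symbol D) :=
  match a with
  | inl i => rhs G i
  | inr c => [:: term c]
  end.

Definition rewrite_string (D : nat) (G : seq (seq (symbol D)))
    (alpha : seq (symbol D)) : seq (symbol D) :=
  flatten [seq rewrite_symbol G a | a <- alpha].

(* Since the right-hand side of A_i only involves nonterminals of larger index,
   [size G] parallel rewriting steps leave only terminals; the final [pmap]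
   merely changes the type and drops nothing (lemma [expansionE]). *)
Definition expansion (D : nat) (G : grammar D) (alpha : seq (symbol D)) :
  seq 'I_D :=
  pmap (fun a : symbol D => if a is inr c then Some c else None)
       (iter (size G) (rewrite_string G) alpha).

Definition generated (D : nat) (G : grammar D) : seq 'I_D :=
  expansion G [:: nonterm D 0].

Lemma expansionE (D : nat) (G : grammar D) (alpha : seq (symbol D)) :
  map (@term D) (expansion G alpha) = iter (size G) (rewrite_string G) alpha.
Proof.
have step k j : nonterm D j \in iter k (rewrite_string G) alpha ->
    k <= j /\ (0 < k -> j < size G).
  elim: k j => [|k IHk] j //=.
  case/flattenP=> s /mapP[[i|c] a_in ->] /=; last by rewrite inE.
  have [ki _] := IHk i a_in.
  case: (ltnP i (size G)) => [i_lt|le_i]; last by rewrite /rhs nth_default.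
  have [_ [_ Gok]] := (rulesP G, (rulesP G).2 i i_lt).
  by move=> /Gok/andP[ij jG]; split=> //; apply: leq_ltn_trans ij.
have [n_gt0 _] := rulesP G.
rewrite /expansion.
have: forall j, nonterm D j \notin iter (size G) (rewrite_string G) alpha.
  move=> j; apply/negP => /step[nj /(_ n_gt0)].
  by rewrite ltnNge nj.
elim: (iter _ _ _) => [|[i|c] s IHs] //= nt.
  by have := nt i; rewrite inE eqxx.
congr (_ :: _); apply: IHs => j; apply: contra (nt j) => jin.
by rewrite inE jin orbT.
Qed.

Definition generates (D : nat) (G : grammar D) (w : seq 'I_D) : Prop :=
  generated G = w.

Definition grammar_transform (D : nat) (J : grammar D -> Prop)
    (Gamma : nonempty_string D -> grammar D) : Prop :=
  forall w, J (Gamma w) /\ generates (Gamma w) (val w).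

Definition flat (D : nat) (G : grammar D) : Prop :=
  forall i, 0 < i < size G -> forall j, nonterm D j \notin rhs G i.

Definition distinct_long_rules (D : nat) (G : grammar D) : Prop :=
  (forall i j, i < size G -> j < size G ->
     expansion G (rhs G i) = expansion G (rhs G j) -> i = j) /\
  (forall i, i < size G ->
     1 < size (rhs G i) \/
     [/\ i = 0, size (rhs G i) = 1 & size (generated G) = 1]).

Definition secondary_used_twice (D : nat) (G : grammar D) : Prop :=
  forall i, 0 < i < size G -> 2 <= count_mem (nonterm D i) (flatten G).

Definition occurs_at (T : eqType) (s alpha : seq T) (p : nat) : Prop :=
  prefix s (drop p alpha).

(* The disjunct [q + 2 <= p] is covered by exchanging the two occurrences. *)
Definition pairs_once (D : nat) (G : grammar D) : Prop :=
  forall (a b : symbol D) (i j p q : nat),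
    i < size G -> j < size G ->
    occurs_at [:: a; b] (rhs G i) p -> occurs_at [:: a; b] (rhs G j) q ->
    ~ (i <> j \/ p + 2 <= q).

Definition start_pairs_once (D : nat) (G : grammar D) : Prop :=
  forall (a b : symbol D) (p q : nat),
    occurs_at [:: a; b] (rhs G 0) p -> occurs_at [:: a; b] (rhs G 0) q ->
    ~ (p + 2 <= q).

Definition irreducible (D : nat) (G : grammar D) : Prop :=
  [/\ distinct_long_rules G, secondary_used_twice G & pairs_once G].

Definition partially_irreducible (D : nat) (G : grammar D) : Prop :=
  [/\ distinct_long_rules G, secondary_used_twice G & start_pairs_once G].

(* In w = x s y s z, the first copy of s is the factor [drop i (take j w)]
   between positions i <= j, and the second one is a factor of [drop j w]. *)
Definition longest_repeat (T : eqType) (w : seq T) : nat :=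
  \max_(j < (size w).+1)
    \max_(i < j.+1 | infix (drop i (take j w)) (drop j w)) (j - i).

Lemma longest_repeat_ge (T : eqType) (x s y z : seq T) :
  size s <= longest_repeat (x ++ s ++ y ++ s ++ z).
Proof.
set w := x ++ _.
have hj : size (x ++ s) < (size w).+1.
  by rewrite ltnS /w catA [X in _ <= X]size_cat leq_addr.
have hi : size x < (size (x ++ s)).+1 by rewrite ltnS size_cat leq_addr.
apply: leq_trans (leq_bigmax (Ordinal hj)).
rewrite -[X in X <= _](addKn (size x)) -size_cat.
apply: (@leq_bigmax_cond _ _ (fun i : 'I_ _ => size (x ++ s) - i) (Ordinal hi)).
rewrite /= /w catA take_size_cat // drop_size_cat // drop_size_cat //.
exact: infix_infix.
Qed.

Lemma longest_repeat_attained (T : eqType) (w : seq T) :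
  exists x s y z, w = x ++ s ++ y ++ s ++ z /\ size s = longest_repeat w.
Proof.
pose good k := exists x s y z : seq T,
  w = x ++ s ++ y ++ s ++ z /\ size s = k.
have good0 : good 0 by exists [::], [::], [::], w.
have goodmax m n : good m -> good n -> good (maxn m n).
  by move=> gm gn; rewrite /maxn; case: ifP.
change (good (longest_repeat w)).
apply: big_ind => // j _; apply: big_ind => // i /infixP[y [z e]].
exists (take i w), (drop i (take j w)), y, z; split; last first.
  by rewrite size_drop size_takel // -ltnS.
rewrite -e catA.
have -> : take i w = take i (take j w) by rewrite take_takel // -ltnS.
by rewrite cat_take_drop cat_take_drop.
Qed.

(* Main.v *)
(* Cut every right-hand side into blocks of two consecutive symbols.  When no
   digram repeats, the blocks are pairwise distinct words over an alphabet of
   n - 1 + D symbols, so there are at most (n - 1 + D)^2 of them.  For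
   irreducible grammars this bounds all rules at once; for flat partially
   irreducible grammars it bounds the start rule, and each secondary rule,
   being used twice in the start rule, is a nonoverlapping repeat of w, hence
   no longer than L(w). *)
Require Import Defs.
From mathcomp Require Import all_boot all_order all_algebra.
From mathcomp Require Import zify.
Import Order.TTheory GRing.Theory Num.Theory.

Lemma occurs_at_digram (T : eqType) (x0 : T) (s : seq T) (p : nat) :
  p.+1 < size s -> occurs_at [:: nth x0 s p; nth x0 s p.+1] s p.
Proof.
move=> ps; rewrite /occurs_at (drop_nth x0 (ltnW ps)) (drop_nth x0 ps).
by rewrite /= !eqxx prefix0s.
Qed.

(** Blocks start at even positions, so distinct blocks never overlap and the hypothesis makes them
    distinct pairs over [S]. Halving drops the possible odd last symbol. *)
Lemma sum_half_size_le (T : eqType) (x0 : T) (S : seq T) (ss : seq (seq T)) :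
  (forall s, s \in ss -> {subset s <= S}) ->
  (forall (a b : T) (i j p q : nat), i < size ss -> j < size ss ->
     occurs_at [:: a; b] (nth [::] ss i) p ->
     occurs_at [:: a; b] (nth [::] ss j) q -> ~ (i <> j \/ p + 2 <= q)) ->
  \sum_(s <- ss) (size s)./2 <= size S ^ 2.
Proof.
move=> sS once.
pose blocks i := iota 0 (size (nth [::] ss i))./2.
pose f i k := (nth x0 (nth [::] ss i) k.*2, nth x0 (nth [::] ss i) k.*2.+1).
(* Both positions of a block are in range, so the default [x0] is never read. *)
have blockP i k : k \in blocks i -> k.*2.+1 < size (nth [::] ss i).
  rewrite mem_iota => ki; have := odd_double_half (size (nth [::] ss i)); lia.
pose ps := [seq f i k | i <- iota 0 (size ss), k <- blocks i].
have ps_uniq : uniq ps.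
  apply: allpairs_uniq_dep => [|i _|]; [exact: iota_uniq|exact: iota_uniq|].
  move=> _ _ /allpairsPdep[i [k [iss ki ->]]] /allpairsPdep[j [l [jss lj ->]]].
  rewrite /= /f => -[e1 e2].
  have {}iss : i < size ss by move: iss; rewrite mem_iota.
  have {}jss : j < size ss by move: jss; rewrite mem_iota.
  have oi := occurs_at_digram _ x0 _ _ (blockP _ _ ki).
  have oj := occurs_at_digram _ x0 _ _ (blockP _ _ lj).
  rewrite -e1 -e2 in oj.
  have eij : i = j.
    by apply/eqP/negP => /negP/eqP nij; apply: (once _ _ _ _ _ _ iss jss oi oj); left.
  (* The hypothesis orders the two positions; using it both ways excludes [k < l] and [l < k]. *)
  have := once _ _ _ _ _ _ iss jss oi oj.
  have := once _ _ _ _ _ _ jss iss oj oi.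
  rewrite -eij => n1 n2; congr existT.
  by case: (ltngtP k l) => // kl; [case: n2|case: n1]; right; lia.
have -> : \sum_(s <- ss) (size s)./2 = size ps.
  rewrite size_allpairs_dep sumnE big_map (big_nth [::]) /index_iota subn0.
  by apply: eq_bigr => i _; rewrite size_iota.
rewrite expnS expn1 -(size_allpairs pair).
apply: uniq_leq_size => // _ /allpairsPdep[i [k [iss ki ->]]].
have lt := blockP _ _ ki.
have mem : nth [::] ss i \in ss by rewrite mem_nth //; move: iss; rewrite mem_iota.
apply: allpairs_f; apply: (sS _ mem); apply: mem_nth => //; exact: ltnW.
Qed.

Lemma count_mem_ge2 (T : eqType) (a : T) (s : seq T) :
  2 <= count_mem a s -> exists x y z, s = x ++ a :: y ++ a :: z.
Proof.
elim: s => //= b s IH; case: eqVneq => [->|_] s2.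
  have: a \in s by rewrite -has_pred1 has_count; lia.
  by case/splitPr=> y z; exists [::], y, z.
by have [x [y [z ->]]] := IH s2; exists (b :: x), y, z.
Qed.

Section Grammar.
Variables (D : nat).
Implicit Types G : grammar D.

(** Index 0 is left out: a right-hand side contains only nonterminals of larger index than its own,
    so the start symbol never occurs. *)
Definition grammar_symbols G : seq (symbol D) :=
  map (@nonterm D) (iota 1 (size G).-1) ++ map (@term D) (enum 'I_D).

Lemma size_grammar_symbols G : size (grammar_symbols G) = (size G).-1 + D.
Proof. by rewrite size_cat 2!size_map size_iota size_enum_ord. Qed.

Lemma rhs_grammar_symbols G (i : nat) :
  i < size G -> {subset rhs G i <= grammar_symbols G}.
Proof.
move=> iG [j|c] js; rewrite mem_cat; last by rewrite orbC map_f ?mem_enum.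
have [_ /(_ j js)] := (rulesP G).2 i iG.
by move=> ij; rewrite (map_f (@nonterm D)) // mem_iota; lia.
Qed.

Lemma iter_rewrite_cat (G : seq (seq (symbol D))) k s t :
  iter k (rewrite_string G) (s ++ t) =
  iter k (rewrite_string G) s ++ iter k (rewrite_string G) t.
Proof.
by elim: k => //= k ->; rewrite {1}/rewrite_string map_cat flatten_cat.
Qed.

Lemma iter_rewrite_terminal (G : seq (seq (symbol D))) k s :
  (forall j, nonterm D j \notin s) -> iter k (rewrite_string G) s = s.
Proof.
move=> st; elim: k => //= k ->; elim: s st => [|[j|c] s IH] st //.
  by have := st j; rewrite inE eqxx.
by rewrite /rewrite_string /= -/(rewrite_string G s) IH.
Qed.

Lemma yk_lengthE G :
  yk_length G = size (rhs G 0) + \sum_(1 <= i < size G) size (rhs G i).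
Proof. by rewrite /yk_length (big_nth [::]) big_ltn // (rulesP G).1. Qed.

Lemma irreducible_yk_length G : irreducible G ->
  yk_length G <= 2 * ((size G).-1 + D) ^ 2 + size G.
Proof.
case=> _ _ once.
have := @sum_half_size_le _ (nonterm D 0) (grammar_symbols G) G.
rewrite size_grammar_symbols => /(_ _ once) H.
have {H}: \sum_(s <- G) (size s)./2 <= ((size G).-1 + D) ^ 2.
  by apply: H => s /(nthP [::])[i iG <-]; exact: rhs_grammar_symbols.
(* Each rule may leave one symbol outside its blocks; this costs [size G] in total. *)
move=> H; apply: (@leq_trans (\sum_(s <- G) (2 * (size s)./2 + 1))).
  apply: leq_sum => s _; have := odd_double_half (size s); lia.
by rewrite big_split /= -big_distrr /= sum1_size leq_add2r leq_mul2l.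
Qed.

Lemma start_rule_size G : start_pairs_once G ->
  size (rhs G 0) <= 2 * ((size G).-1 + D) ^ 2 + 1.
Proof.
move=> once.
have := @sum_half_size_le _ (nonterm D 0) (grammar_symbols G) [:: rhs G 0].
rewrite size_grammar_symbols big_seq1 => H.
suff: (size (rhs G 0))./2 <= ((size G).-1 + D) ^ 2.
  have := odd_double_half (size (rhs G 0)); lia.
apply: H => [s|a b [|i] [|j] p q //= _ _ op oq].
  by rewrite inE => /eqP->; apply: rhs_grammar_symbols; case: (rulesP G).
by case=> // pq; exact: once op oq pq.
Qed.

(** By flatness both uses of the nonterminal lie in the start rule, and each expands to the same
    terminal string, which gives two disjoint copies. *)
Lemma flat_secondary_size G (i : nat) :
  flat G -> secondary_used_twice G -> 0 < i < size G ->
  size (rhs G i) <= longest_repeat (generated G).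
Proof.
move=> fG twice iG.
have [x [y [z e]]] : exists x y z,
    rhs G 0 = x ++ nonterm D i :: y ++ nonterm D i :: z.
  apply: count_mem_ge2; apply: leq_trans (twice i iG) _.
  have -> : flatten G = rhs G 0 ++ flatten (behead G).
    by rewrite /rhs; case: (rules G).
  rewrite count_cat -[leqRHS]addn0 leq_add2l leqn0 -/(count_mem _ _).
  apply/eqP/count_memPn/flattenP => -[s /(nthP [::])[k]].
  rewrite size_behead nth_behead ltn_predRL => kG <-; apply/negP; exact: fG.
have term_i k : iter k (rewrite_string G) (rhs G i) = rhs G i.
  by apply: iter_rewrite_terminal; apply: fG.
have sz : size (pmap (fun a : symbol D => if a is inr c then Some c else None)
                  (rhs G i)) = size (rhs G i).
  have := fG i iG; elim: (rhs G i) => [|[j|c] s IH] //= st.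
    by have := st j; rewrite inE eqxx.
  by rewrite IH.
have step j : rewrite_string G [:: nonterm D j] = rhs G j.
  by rewrite /rewrite_string /= cats0.
(* A secondary index exists, so there are at least two rewriting steps: one opens the start symbol,
   one opens the two copies of [nonterm D i]. Further steps fix their terminal right-hand side. *)
rewrite -sz /generated /expansion; have -> : size G = (size G).-2.+2 by lia.
rewrite iterSr step e -cat1s -[nonterm D i :: z]cat1s !iter_rewrite_cat.
rewrite [iter _ _ [:: nonterm D i]]iterSr step term_i !pmap_cat.
exact: longest_repeat_ge.
Qed.

Lemma flat_partially_irreducible_yk_length G :
  flat G -> partially_irreducible G ->
  yk_length G <= 2 * ((size G).-1 + D) ^ 2 + 1
                 + (size G).-1 * longest_repeat (generated G).
Proof.
move=> fG [_ twice once]; rewrite yk_lengthE leq_add ?start_rule_size //.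
rewrite -subn1 -sum_nat_const_nat big_nat [X in _ <= X]big_nat.
by apply: leq_sum => i iG; exact: flat_secondary_size.
Qed.

End Grammar.

Local Open Scope ring_scope.

(** This reduces both claims to inequalities between natural numbers, with [n] the vocabulary term
    plus [D + 1]. *)
Lemma sqrt_half_lt (R : rcfType) (m n : nat) :
  (m < 2 * n ^ 2)%N -> Num.sqrt (m%:R / 2) < n%:R :> R.
Proof.
move=> mn; rewrite -[ltRHS]ger0_norm ?ler0n // -sqrtr_sqr ltr_sqrt.
  by rewrite ltr_pdivrMr ?ltr0n // -natrX -natrM ltr_nat mulnC.
by rewrite exprn_gt0 // ltr0n; case: n mn.
Qed.

Theorem theorem4 (R : rcfType) (D : nat) (D_gt0 : (0 < D)%N) :
  (forall Gamma : nonempty_string D -> grammar D,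
     grammar_transform (fun G => flat G /\ partially_irreducible G) Gamma ->
     forall w : nonempty_string D,
       (vocabulary_size (Gamma w))%:R * (longest_repeat (val w))%:R >
         Num.sqrt ((yk_length (Gamma w))%:R / 2) - D%:R - 1 :> R)
  /\
  (forall Gamma : nonempty_string D -> grammar D,
     grammar_transform (@irreducible D) Gamma ->
     forall w : nonempty_string D,
       (vocabulary_size (Gamma w))%:R >
         Num.sqrt ((yk_length (Gamma w))%:R / 2) - D%:R - 1 :> R).
Proof.
split=> Gamma GammaP w; have [JG e] := GammaP w; rewrite -?e;
  move: (Gamma w) JG {e} => G JG; rewrite !ltrBlDr -?natrM natr1 -natrD;
  apply: sqrt_half_lt; have [n_gt0 _] := rulesP G.
- have [fG pG] := JG.
  have := flat_partially_irreducible_yk_length _ _ fG pG.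
  rewrite /vocabulary_size; set N := yk_length G; set L := longest_repeat _.
  (* Without secondary rules [L] may be 0, but then [N <= 2 * D ^ 2 + 1] already suffices. *)
  case: (posnP (size G).-1) => [n1|n2].
    have -> : size G = 1%N by lia.
    nia.
  (* The secondary rule of index 1 is nonempty and its expansion repeats, so [L] is positive and
     [(size G).-1 <= size G * L]. *)
  have L_gt0 : (0 < L)%N.
    have iG : (0 < 1 < size G)%N by lia.
    have [_ twice _] := pG.
    apply: leq_trans (flat_secondary_size _ _ _ fG twice iG).
    by rewrite lt0n size_eq0; have [] := (rulesP G).2 1%N (andP iG).2.
  have Ln : ((size G).-1 * L <= size G * L)%N by rewrite leq_mul2r leq_pred orbT.
  have sq : (((size G).-1 + D) ^ 2 <= (size G * L + D) ^ 2)%N.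
    by rewrite leq_sqr leq_add2r (leq_trans (leq_pred _)) // leq_pmulr.
  (* With [m = size G * L], the claim follows from [2 * (m + D) ^ 2 + 1 + m < 2 * (m + 1 + D) ^
     2]. *)
  move=> NL; apply: leq_ltn_trans NL _.
  move: Ln sq; move: (size G * L)%N => m; nia.
- have := irreducible_yk_length _ _ JG; rewrite /vocabulary_size => H.
  apply: leq_ltn_trans H _; nia.
Qed.
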